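(* Let $g=\{g_1,\dots,g_m\}\subset\mathbb{R}[x]$ and let $f\in\mathbb{R}[x]$ be nonnegative on $S(g)$. Let $\varepsilon>0$ and let $d\in\mathbb{N}$ be such that at least one of the following two conditions is satisfied: (i) $d\ge 1+\lfloor \deg(f)/2\rfloor$; (ii) $d\ge\lceil\deg(f)/2\rceil$ and $g_m=f+\lambda$ for some real $\lambda\ge 0$. Then there exists $k_\varepsilon\in\mathbb{N}$ such that $$\theta^{k_\varepsilon}\left(f+\varepsilon\,\theta^{d}\right)\in Q_{k_\varepsilon+d}(g).$$
   Context: $x=(x_1,\dots,x_n)$; $\mathbb{N}$ contains $0$; $\theta(x):=1+\|x\|_2^2$. $\Sigma[x]_t$ is the set of sums of squares of real polynomials that have degree at most $2t$ (with $\Sigma[x]_t=\{0\}$ for $t<0$). $S(g):=\{x\in\mathbb{R}^n: g_j(x)\ge0,\ j=1,\dots,m\}$ (not assumed compact). With $u_j:=\lceil\deg(g_j)/2\rceil$, the truncated quadratic module of order $t$ is $$Q_t(g):=\Big\{\sigma_0+\sum_{j=1}^m\sigma_jg_j:\ \sigma_0\in\Sigma[x]_t,\ \sigma_j\in\Sigma[x]_{t-u_j},\ j=1,\dots,m\Big\}.$$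
   Formalization: When d = 0 (so f is constant), S(g) is additionally assumed nonempty; without this the claim fails, e.g. n = 1, g = (x, -x-1, 1), f = -1, λ = 2, d = 0, ε = 1/2. *)

(* Defs.v *)
From HB Require Import structures.
From mathcomp Require Import all_boot all_order all_algebra.
From mathcomp Require Import reals.
From mathcomp Require Import mpoly.

Set Implicit Arguments.
Unset Strict Implicit.
Unset Printing Implicit Defensive.

Import Order.TTheory GRing.Theory Num.Theory.
Local Open Scope ring_scope.

Section Defs.
Variables (R : realType) (n : nat).
Implicit Types (p : {mpoly R[n]}) (x : 'I_n -> R).

(* [msize] is one more than the total degree; the zero polynomial gets
   degree 0. *)
Definition mpdeg p : nat := (msize p).-1.

Definition theta : {mpoly R[n]} := 1 + \sum_(i < n) 'X_i ^+ 2.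

Definition is_sos p : Prop :=
  exists s : seq {mpoly R[n]}, p = \sum_(q <- s) q ^+ 2.

(* The truncation order is an integer because it is used at t - u_j, which may
   be negative. *)
Definition sos_trunc (t : int) p : Prop :=
  match t with
  | Posz k => is_sos p /\ (mpdeg p <= 2 * k)%N
  | Negz _ => p = 0
  end.

Definition semialg (m : nat) (g : 'I_m -> {mpoly R[n]}) x : Prop :=
  forall j : 'I_m, 0 <= (g j).@[x].

Definition half_deg p : nat := uphalf (mpdeg p).

Definition qmodule_trunc (m : nat) (g : 'I_m -> {mpoly R[n]}) (t : nat) p :
    Prop :=
  exists (sigma0 : {mpoly R[n]}) (sigma : 'I_m -> {mpoly R[n]}),
    [/\ sos_trunc t%:Z sigma0,
        forall j : 'I_m, sos_trunc (t%:Z - (half_deg (g j))%:Z) (sigma j)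
      & p = sigma0 + \sum_(j < m) sigma j * g j].

End Defs.

(* Pitfall: a representation of theta^k (f + eps theta^d) in Q_(k+d)(g) may fail
   to exist when S(g) is empty, d = 0, f is a negative constant and
   g_m = f + lambda.  Take n = 1, g = (x, - x - 1, 1), f = -1, lambda = 2,
   eps = 1/2: in an identity
     - theta^k / 2 = sigma0 + sigma1 x - sigma2 (x + 1) + sigma3
   in Q_k(g), sigma1 x and sigma2 (x + 1) have degree less than 2k, so the
   coefficient of x^(2k) is nonnegative on the right and -1/2 on the left.
   Hence the case d = 0 needs S(g) to be nonempty; d > 0 does not. *)
Arguments theta R n : clear implicits.

(* Main.v *)
Require Import Defs.
From HB Require Import structures.
From mathcomp Require Import all_boot all_order all_algebra.
From mathcomp Require Import reals.
From mathcomp Require Import mpoly.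
From mathcomp Require Import zify ring lra fraction boolp classical_sets.

Set Implicit Arguments.
Unset Strict Implicit.
Unset Printing Implicit Defensive.

Import Order.TTheory GRing.Theory Num.Theory.
Local Open Scope ring_scope.

(** Work projectively. Let A be the ring of fractions p / theta^k with
    deg p <= 2 k: these are the even polynomial functions on the unit sphere
    of R^(n+1), that is, functions on the projective closure of R^n. The
    fractions p / theta^k with p in Q_k(g) form a quadratic module M of A, and
    the conclusion says that (f + eps theta^d) / theta^d lies in M: clearing
    denominators in an equality p / theta^k = (f + eps theta^d) / theta^d
    gives the factor theta^k and the order k + d
    ([qmodule_frac_hfrac]).

    The closure being compact, M is archimedean ([archimedean_qmodule_frac]),
    for an elementary reason: theta^k - x^(2 alpha) is a sum of squares as soon
    as |alpha| <= k. Hence the archimedean Positivstellensatz applies: an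
    element which is positive under every ring morphism phi : A -> R that is
    nonnegative on M belongs to M ([archimedean_positivstellensatz]).

    It remains to know these morphisms. Put t = phi (1 / theta) >= 0. If
    t <> 0, phi is the evaluation at a point x of R^n, which lies in S(g)
    since phi is nonnegative on the g_j / theta^(u_j); so
    phi (f / theta^d) = t^d f(x) >= 0. If t = 0, phi is a point at infinity,
    where p / theta^k vanishes whenever deg p < 2 k; under condition (i) this
    kills f / theta^d, and under condition (ii) either the same happens or
    f / theta^d and g_m / theta^d take the same value, which is nonnegative.
    In all cases phi ((f + eps theta^d) / theta^d) >= eps > 0. The case d = 0
    has no room for the degree argument: there f is a constant, which a
    point of S(g) shows to be nonnegative.

    The Positivstellensatz is proved algebraically. A maximal proper quadratic
    module Q containing M is a total order up to its support, and
    phi a = sup {r | a - r in Q} is a ring morphism ([ex_nonneg_character]).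
    Applied to the module generated by M and - f, this gives an identity
    s f = 1 + m with s a sum of squares and m in M, from which f in M follows
    by lowering step by step a constant r such that f + r is in M
    ([qm_descent]). *)

(** * Quadratic modules of a commutative ring *)

Definition quadratic_module (A : comNzRingType) (M : A -> Prop) : Prop :=
  [/\ M 1, forall a b, M a -> M b -> M (a + b)
    & forall a b, M b -> M (a ^+ 2 * b)].

Inductive sum_of_squares (A : comNzRingType) : A -> Prop :=
| SumOfSquares0 : sum_of_squares 0
| SumOfSquaresD a s : sum_of_squares s -> sum_of_squares (a ^+ 2 + s).

(** The quadratic module generated by [M] and [a]. *)
Definition adjoin (A : comNzRingType) (M : A -> Prop) (a x : A) : Prop :=
  exists m s, [/\ M m, sum_of_squares s & x = m + s * a].

Section QuadraticModule.
Variables (A : comNzRingType) (M : A -> Prop).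
Hypothesis qmM : quadratic_module M.

Lemma qm_add a b : M a -> M b -> M (a + b).
Proof. by case: qmM => _ + _; apply. Qed.

Lemma qm_sqrM a b : M b -> M (a ^+ 2 * b).
Proof. by case: qmM => _ _; apply. Qed.

Lemma qm1 : M 1.
Proof. by case: qmM. Qed.

Lemma qm_sqr a : M (a ^+ 2).
Proof. by rewrite -[X in M X]mulr1; exact: qm_sqrM qm1. Qed.

Lemma qm0 : M 0.
Proof.
have <- : (0 : A) ^+ 2 = 0 by rewrite expr0n.
exact: qm_sqr.
Qed.

Lemma qm_sosM s b : sum_of_squares s -> M b -> M (s * b).
Proof.
move=> sos_s Mb; elim: sos_s => [|a t _ IHt]; first by rewrite mul0r; exact: qm0.
by rewrite mulrDl; apply: qm_add => //; exact: qm_sqrM.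
Qed.

End QuadraticModule.

Lemma qm_sum_of_squares (A : comNzRingType) :
  quadratic_module (@sum_of_squares A).
Proof.
split=> [|a b sa sb|a b sb].
- by rewrite -(expr1n _ 2) -[_ ^+ 2]addr0; do 2!constructor.
- by elim: sa => [|c s _ IHs]; rewrite ?add0r // -addrA; constructor.
elim: sb => [|c s _ IHs]; first by rewrite mulr0; constructor.
by rewrite mulrDr -exprMn; constructor.
Qed.

Section Adjoin.
Variables (A : comNzRingType) (M : A -> Prop).
Hypothesis qmM : quadratic_module M.

Lemma sub_adjoin a x : M x -> adjoin M a x.
Proof. by move=> Mx; exists x, 0; rewrite mul0r addr0; split=> //; constructor. Qed.

Lemma adjoin_gen a : adjoin M a a.
Proof.
exists 0, 1; rewrite mul1r add0r; split=> //; first exact: qm0.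
exact: qm1 (@qm_sum_of_squares A).
Qed.

Lemma adjoin_qm a : quadratic_module (adjoin M a).
Proof.
have qmS := @qm_sum_of_squares A.
split=> [|x y [m [s [Mm Ss ->]]] [m' [s' [Mm' Ss' ->]]]|x y [m [s [Mm Ss ->]]]].
- by apply: sub_adjoin; exact: qm1.
- exists (m + m'), (s + s'); split; [exact: qm_add|exact: qm_add|ring].
by exists (x ^+ 2 * m), (x ^+ 2 * s); split; [exact: qm_sqrM|exact: qm_sqrM|ring].
Qed.

Lemma ex_maximal_qm :
  ~ M (- 1) ->
  exists Q : A -> Prop,
    [/\ quadratic_module Q, ~ Q (- 1), forall a, M a -> Q a
      & forall Q' : A -> Prop, quadratic_module Q' -> ~ Q' (- 1) ->
          (forall a, Q a -> Q' a) -> forall a, Q' a -> Q a].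
Proof.
move=> properM.
(* The empty set is let in because it is the union of the empty chain; a
   maximal element is then nonempty, [M] being admissible. *)
pose good (X : A -> Prop) :=
  [/\ quadratic_module X, ~ X (- 1) & forall a, M a -> X a].
pose P : set (set A) := fun X => (exists a, X a) -> good X.
have goodM : good M by split.
have [F FP totF|Q [PQ maxQ]] := @Zorn_bigcup A P.
  case=> a0 [X0 FX0 X0a0].
  have goodX0 : good X0 by apply: FP => //; exists a0.
  split.
  - split=> [|a b [X FX Xa] [Y FY Yb]|a b [X FX Xb]].
    + by exists X0 => //; case: goodX0 => + _ _; exact: qm1.
    + case: (totF _ _ FX FY) => [XY|YX].
        exists Y => //; apply: qm_add => //; last exact: XY.
        by case: (FP _ FY _) => //; exists b.
      exists X => //; apply: qm_add => //; last exact: YX.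
      by case: (FP _ FX _) => //; exists a.
    + exists X => //; apply: qm_sqrM => //.
      by case: (FP _ FX _) => //; exists b.
  - case=> X FX X1; have [|_ + _] := FP X FX _; last exact.
    by exists (- 1).
  - by move=> a Ma; exists X0 => //; case: goodX0 => _ _; exact.
have goodQ : good Q.
  have [|Q0] := pselect (exists a, Q a); first exact: PQ.
  exfalso; apply: (maxQ M) => //; split; first by move=> a Qa; case: Q0; exists a.
  by move=> MQ; apply: Q0; exists 1; apply: MQ; exact: qm1.
case: (goodQ) => qmQ properQ MQ; exists Q; split=> // Q' qmQ' properQ' QQ' a Q'a.
apply: contrapT => nQa; apply: (maxQ Q'); first by split=> // Q'Q; apply/nQa/Q'Q.
by move=> _; split=> // b Mb; apply/QQ'/MQ.
Qed.

End Adjoin.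

(** * Characters of archimedean quadratic modules *)

(** The weak form of the archimedean property, one upper bound for each
    element, is enough: a lower bound of [a] is an upper bound of [- a]. *)
Definition archimedean_for (R : realType) (A : comNzRingType)
    (iota : {rmorphism R -> A}) (M : A -> Prop) : Prop :=
  forall a, exists r : R, M (iota r - a).

Section Scalars.
Variables (R : realType) (A : comNzRingType) (iota : {rmorphism R -> A}).
Variable M : A -> Prop.
Hypothesis qmM : quadratic_module M.

Lemma qm_scale (r : R) a : 0 <= r -> M a -> M (iota r * a).
Proof.
by move=> r0 Ma; rewrite -(sqr_sqrtr r0) rmorphXn; exact: qm_sqrM.
Qed.

Lemma qm_scalar (r : R) : 0 <= r -> M (iota r).
Proof. by move=> r0; rewrite -[iota r]mulr1; apply: qm_scale => //; exact: qm1. Qed.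

Lemma qm_unscale (r : R) a : 0 < r -> M (iota r * a) -> M a.
Proof.
move=> r0 Mra; have : M (iota r^-1 * (iota r * a)).
  by apply: qm_scale => //; rewrite invr_ge0 ltW.
by rewrite mulrA -rmorphM mulVf ?gt_eqF // rmorph1 mul1r.
Qed.

Lemma qm_addr_ge (r r' : R) a : r <= r' -> M (a + iota r) -> M (a + iota r').
Proof.
move=> le_rr' Ma; have -> : a + iota r' = a + iota r + iota (r' - r).
  by rewrite rmorphB; ring.
by apply: qm_add => //; apply: qm_scalar; rewrite subr_ge0.
Qed.

Lemma qm_scalar_ge0 (r : R) : ~ M (- 1) -> M (iota r) -> 0 <= r.
Proof.
move=> properM Mr; rewrite leNgt; apply/negP => r0; apply: properM.
apply: (@qm_unscale (- r)); first by rewrite oppr_gt0.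
by rewrite rmorphN mulrN mulr1 opprK.
Qed.

End Scalars.

Section MaximalQuadraticModule.
Variables (R : realType) (A : comNzRingType) (iota : {rmorphism R -> A}).
Variable Q : A -> Prop.
Hypothesis qmQ : quadratic_module Q.
Hypothesis properQ : ~ Q (- 1).
Hypothesis maxQ : forall Q' : A -> Prop, quadratic_module Q' -> ~ Q' (- 1) ->
  (forall a, Q a -> Q' a) -> forall a, Q' a -> Q a.
Hypothesis archQ : archimedean_for iota Q.

(** [b] is a difference of two squares, ((b + 1) / 2)^2 - ((b - 1) / 2)^2;
    so the support of a quadratic module, [Q] meet [- Q], is an ideal. *)
Lemma qm_support_ideal a b : Q a -> Q (- a) -> Q (b * a).
Proof.
move=> Qa Qna.
have -> : b * a = (iota 2^-1 * (b + 1)) ^+ 2 * a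
                 + (iota 2^-1 * (b - 1)) ^+ 2 * (- a).
  have h : iota 2^-1 + iota 2^-1 = 1.
    by rewrite -rmorphD -(rmorph1 iota); congr (iota _); lra.
  have -> : (iota 2^-1 * (b + 1)) ^+ 2 * a + (iota 2^-1 * (b - 1)) ^+ 2 * (- a)
    = (iota 2^-1 + iota 2^-1) ^+ 2 * (b * a) by ring.
  by rewrite h expr1n mul1r.
by apply: qm_add => //; exact: qm_sqrM.
Qed.

(** If neither [a] nor [- a] is in [Q], maximality gives - 1 = m + s a and
    - 1 = m' - t a. Eliminating [a] yields s + t + t m + s m' = 0, so [s] is in
    the support, hence so is [s a], and - 1 = m + s a is in [Q]. *)
Lemma qm_total a : Q a \/ Q (- a).
Proof.
have [Qa|nQa] := pselect (Q a); first by left.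
have [Qna|nQna] := pselect (Q (- a)); first by right.
have notproper c : ~ Q c -> adjoin Q c (- 1).
  move=> nQc; apply: contrapT => proper; apply: nQc.
  apply: (maxQ (adjoin_qm qmQ c) proper); first exact: sub_adjoin.
  exact: adjoin_gen.
have [m [s [Qm Ss em]]] := notproper _ nQa.
have [m' [t [Qm' St em']]] := notproper _ nQna.
have Q_s : Q s by rewrite -[s]mulr1; apply: qm_sosM => //; exact: qm1.
have e : - s = t + (t * m + s * m').
  have -> : - s = s * (- 1) by ring.
  rewrite {1}em'.
  have -> : s * (m' + t * - a) = s * m' + t * m - t * (m + s * a) by ring.
  by rewrite -em; ring.
have Qns : Q (- s).
  rewrite e; apply: qm_add => //.
    by rewrite -[t]mulr1; apply: qm_sosM => //; exact: qm1.
  by apply: qm_add => //; exact: qm_sosM.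
exfalso; apply: properQ; rewrite em; apply: qm_add => //.
by rewrite mulrC; exact: qm_support_ideal.
Qed.

(** Totality makes [Q] a Dedekind cut on the real multiples of 1 around each
    [a]; this is the value of [a] at the corresponding point. *)
Definition qm_eval (a : A) : R := sup [set r : R | Q (a - iota r)].

Lemma qm_eval_has_sup a : has_sup [set r : R | Q (a - iota r)].
Proof.
split.
  have [r Qr] := archQ (- a); exists (- r) => /=.
  by rewrite rmorphN opprK addrC -[a]opprK.
have [r Qr] := archQ a; exists r => s /= Qs.
rewrite -subr_ge0; apply: (qm_scalar_ge0 qmQ (iota := iota)) => //.
rewrite rmorphB; have -> : iota r - iota s = iota r - a + (a - iota s) by ring.
exact: qm_add.
Qed.

Lemma qm_eval_near a (e : R) : 0 < e ->
  Q (a - iota (qm_eval a - e)) /\ Q (iota (qm_eval a + e) - a).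
Proof.
move=> e0; split.
  have [r /= Qr lt_r] := sup_adherent e0 (qm_eval_has_sup a).
  rewrite -rmorphN; apply: (qm_addr_ge qmQ _ (r := - r)).
    by rewrite lerN2 ltW.
  by rewrite rmorphN.
have [Qa|] := qm_total (a - iota (qm_eval a + e)); last by rewrite opprB.
have : qm_eval a + e <= qm_eval a.
  by apply: ub_le_sup => //; case: (qm_eval_has_sup a).
by rewrite gerDl leNgt e0.
Qed.

Lemma qm_eval_uniq a (x : R) :
  (forall e, 0 < e -> Q (a - iota (x - e)) /\ Q (iota (x + e) - a)) ->
  qm_eval a = x.
Proof.
have le_gap (u v e : R) : 0 < e -> Q (a - iota (u - e)) -> Q (iota (v + e) - a) ->
    u <= v + (e + e).
  move=> e0 Qu Qv; rewrite -subr_ge0; apply: (qm_scalar_ge0 qmQ (iota := iota)) => //.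
  have -> : v + (e + e) - u = (v + e) - (u - e) by ring.
  by rewrite rmorphB; have := qm_add qmQ Qv Qu; rewrite addrA subrK.
move=> near_x; apply/eqP; rewrite eq_le; apply/andP; split;
  apply/ler_addgt0Pr => e e0; rewrite [e]splitr;
  have h0 : 0 < e / 2 by rewrite divr_gt0.
  have [ge_a _] := qm_eval_near a h0; have [_ le_x] := near_x _ h0.
  exact: le_gap h0 ge_a le_x.
have [_ le_a] := qm_eval_near a h0; have [ge_x _] := near_x _ h0.
exact: le_gap h0 ge_x le_a.
Qed.

Lemma qm_eval_ge0 a : Q a -> 0 <= qm_eval a.
Proof.
move=> Qa; apply: ub_le_sup; first by case: (qm_eval_has_sup a).
by rewrite /= rmorph0 subr0.
Qed.

Lemma qm_eval_scalar r : qm_eval (iota r) = r.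
Proof.
apply: qm_eval_uniq => e e0.
by split; rewrite -rmorphB; apply: (qm_scalar iota qmQ); lra.
Qed.

Lemma qm_evalD a b : qm_eval (a + b) = qm_eval a + qm_eval b.
Proof.
apply: qm_eval_uniq => e e0.
have [h h0 ->] : exists2 h, 0 < h & e = h + h.
  by exists (e / 2); [rewrite divr_gt0|exact: splitr].
have [al ar] := qm_eval_near a h0; have [bl br] := qm_eval_near b h0.
split.
  have := qm_add qmQ al bl; congr (Q _).
  by rewrite !rmorphB !rmorphD; ring.
have := qm_add qmQ ar br; congr (Q _).
by rewrite !rmorphD; ring.
Qed.

Lemma qm_evalN a : qm_eval (- a) = - qm_eval a.
Proof.
apply/eqP; rewrite -subr_eq0 opprK -qm_evalD addNr -(rmorph0 iota).
by rewrite qm_eval_scalar.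
Qed.

Lemma qm_evalZ r a : qm_eval (iota r * a) = r * qm_eval a.
Proof.
have pos s : 0 < s -> qm_eval (iota s * a) = s * qm_eval a.
  move=> s0; apply: qm_eval_uniq => e e0.
  have [al ar] := qm_eval_near a (divr_gt0 e0 s0).
  have es : s * (e / s) = e by rewrite mulrC divfK ?gt_eqF.
  split.
    have := qm_scale iota qmQ (ltW s0) al; congr (Q _).
    by rewrite mulrBr -rmorphM mulrBr es.
  have := qm_scale iota qmQ (ltW s0) ar; congr (Q _).
  by rewrite mulrBr -rmorphM mulrDr es.
have [r0|r0|->] := ltgtP r 0; last 1 first.
- by rewrite rmorph0 !mul0r -(rmorph0 iota) qm_eval_scalar.
- have := pos (- r); rewrite oppr_gt0 => /(_ r0).
  by rewrite rmorphN !mulNr qm_evalN => /oppr_inj.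
- exact: pos.
Qed.

(** The heart of multiplicativity. If e - c and e + c are in [Q], then so is
    e^2 - c^2, although [Q] is not closed under products, because
    2 e (e - c) (e + c) = (e - c)^2 (e + c) + (e + c)^2 (e - c). *)
Lemma qm_eval_sqr0 c : qm_eval c = 0 -> qm_eval (c ^+ 2) = 0.
Proof.
move=> c0; apply/eqP; rewrite eq_le qm_eval_ge0 ?andbT; last exact: qm_sqr.
have sq_le e : 0 < e -> qm_eval (c ^+ 2) <= e ^+ 2.
  move=> e0; have [] := qm_eval_near c e0; rewrite c0 !add0r rmorphN opprK => cl cr.
  rewrite -subr_ge0 -(qm_eval_scalar (e ^+ 2)) -qm_evalN -qm_evalD; apply: qm_eval_ge0.
  apply: (qm_unscale qmQ (iota := iota) (r := e + e)); first exact: addr_gt0.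
  rewrite rmorphD rmorphXn.
  have -> : (iota e + iota e) * (iota e ^+ 2 - c ^+ 2) =
      (iota e - c) ^+ 2 * (c + iota e) + (c + iota e) ^+ 2 * (iota e - c).
    by ring.
  by apply: qm_add => //; exact: qm_sqrM.
rewrite leNgt; apply/negP => c2.
have := sq_le (Num.sqrt (qm_eval (c ^+ 2) / 2)).
rewrite sqrtr_gt0 sqr_sqrtr; last by rewrite divr_ge0 // ltW.
rewrite divr_gt0 // => /(_ isT); lra.
Qed.

Lemma qm_eval_sqr a : qm_eval (a ^+ 2) = qm_eval a ^+ 2.
Proof.
have := @qm_eval_sqr0 (a - iota (qm_eval a)).
rewrite qm_evalD qm_evalN qm_eval_scalar subrr => /(_ erefl).
have -> : (a - iota (qm_eval a)) ^+ 2 =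
    a ^+ 2 - iota (qm_eval a) * a - iota (qm_eval a) * a + iota (qm_eval a ^+ 2).
  by rewrite rmorphXn; ring.
rewrite !qm_evalD !qm_evalN !qm_evalZ qm_eval_scalar; lra.
Qed.

Lemma qm_evalM a b : qm_eval (a * b) = qm_eval a * qm_eval b.
Proof.
have := qm_eval_sqr (a + b); rewrite sqrrD mulr2n !qm_evalD !qm_eval_sqr; lra.
Qed.

Lemma qm_eval_zmod : zmod_morphism qm_eval.
Proof. by move=> a b; rewrite qm_evalD qm_evalN. Qed.

Lemma qm_eval_monoid : monoid_morphism qm_eval.
Proof.
by split; [rewrite -(rmorph1 iota) qm_eval_scalar|exact: qm_evalM].
Qed.

End MaximalQuadraticModule.

(** The point sought is the one at which a maximal proper quadratic module
    above [M], again archimedean, evaluates. *)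
Lemma ex_nonneg_character (R : realType) (A : comNzRingType)
    (iota : {rmorphism R -> A}) (M : A -> Prop) :
  quadratic_module M -> archimedean_for iota M -> ~ M (- 1) ->
  exists phi : {rmorphism A -> R},
    (forall r, phi (iota r) = r) /\ (forall a, M a -> 0 <= phi a).
Proof.
move=> qmM archM /(ex_maximal_qm qmM) [Q [qmQ properQ MQ maxQ]].
have archQ : archimedean_for iota Q.
  by move=> a; have [r Mr] := archM a; exists r; exact: MQ.
pose addphi := GRing.isZmodMorphism.Build _ _ _ (qm_eval_zmod qmQ properQ maxQ archQ).
pose mulphi := GRing.isMonoidMorphism.Build _ _ _ (qm_eval_monoid qmQ properQ maxQ archQ).
pose phi : {rmorphism A -> R} := HB.pack (qm_eval iota Q) addphi mulphi.
exists phi; split=> [r|a Ma]; first exact: qm_eval_scalar.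
by apply: qm_eval_ge0 => //; exact: MQ.
Qed.

(** Given f + r in [M] with r >= 0, multiply it by (N - s)^2 and replace the
    cross term - 2 N s f by - 2 N, using s f - 1 in [M]. For [N] large the
    other terms are absorbed by the archimedean property, and what remains is
    N^2 (f + r) - 1. So [r] can be lowered by 1 / N^2, with [N] independent of
    [r], until it becomes negative. *)
Lemma qm_descent (R : realType) (A : comNzRingType)
    (iota : {rmorphism R -> A}) (M : A -> Prop) (f s : A) :
  quadratic_module M -> archimedean_for iota M ->
  sum_of_squares s -> M (s * f - 1) -> M f.
Proof.
move=> qmM archM sos_s Msf.
have [r1 Mr1] := archM s; have [r2 Mr2] := archM (s ^+ 2 * f).
have [r0 Mr0] := archM (- f).
pose N := 1 + `|r1| + `|r2|.
have N1 : 1 <= N by have := normr_ge0 r1; have := normr_ge0 r2; rewrite /N; lra.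
have MN1 : M (iota (N *+ 2) - s).
  rewrite addrC; apply: (qm_addr_ge qmM _ (r := r1)); last by rewrite addrC.
  by have := ler_norm r1; have := normr_ge0 r1; have := normr_ge0 r2;
     rewrite /N mulr2n; lra.
have MN2 : M (iota (N *+ 2 - 1) - s ^+ 2 * f).
  rewrite addrC; apply: (qm_addr_ge qmM _ (r := r2)); last by rewrite addrC.
  by have := ler_norm r2; have := normr_ge0 r1; have := normr_ge0 r2;
     rewrite /N mulr2n; lra.
have N0 : 0 < N by lra.
have NV : N ^+ 2 * N ^- 2 = 1 by rewrite mulfV // expf_neq0 // gt_eqF.
have step r : 0 <= r -> M (f + iota r) -> M (f + iota (r - N ^- 2)).
  move=> r_ge0 Mfr; apply: (qm_unscale qmM (iota := iota) (r := N ^+ 2)).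
    by rewrite exprn_gt0.
  have -> : iota (N ^+ 2) * (f + iota (r - N ^- 2)) =
      (iota N - s) ^+ 2 * (f + iota r) + iota (N *+ 2) * (s * f - 1)
      + iota r * (s * (iota (N *+ 2) - s)) + (iota (N *+ 2 - 1) - s ^+ 2 * f).
    rewrite mulrDr -rmorphM mulrBr NV !rmorphB rmorphM rmorphMn rmorph1.
    by ring.
  apply: qm_add => //; apply: qm_add => //.
    apply: qm_add => //; first exact: qm_sqrM.
    by apply: qm_scale => //; rewrite mulrn_wge0 // ltW.
  by apply: qm_scale => //; exact: qm_sosM.
have descend k : M (f + iota (r0 - k%:R * N ^- 2)) \/ M f.
  elim: k => [|k [IH|]]; last by right.
    by left; rewrite mul0r subr0 addrC -[f]opprK.
  have [ge0|lt0] := leP 0 (r0 - k%:R * N ^- 2).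
    left; have -> : r0 - k.+1%:R * N ^- 2 = r0 - k%:R * N ^- 2 - N ^- 2.
      by rewrite -natr1; ring.
    exact: step.
  right; rewrite -[f]addr0 -(rmorph0 iota).
  by apply: qm_addr_ge IH => //; exact: ltW.
case: (descend (Num.bound `|r0 * N ^+ 2|)) => // IH.
rewrite -[f]addr0 -(rmorph0 iota); apply: qm_addr_ge IH => //.
rewrite subr_le0 -ler_pdivrMr ?invr_gt0 ?exprn_gt0 // invrK.
by apply: ltW; apply: le_lt_trans (ler_norm _) (archi_boundP (normr_ge0 _)).
Qed.

(** If - 1 is in the module generated by [M] and - f, the descent applies.
    Otherwise that module has a real point, where [f] would be both positive
    and nonpositive. *)
Theorem archimedean_positivstellensatz (R : realType) (A : comNzRingType)
    (iota : {rmorphism R -> A}) (M : A -> Prop) (f : A) :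
  quadratic_module M -> archimedean_for iota M ->
  (forall phi : {rmorphism A -> R},
     (forall r, phi (iota r) = r) -> (forall a, M a -> 0 <= phi a) ->
     0 < phi f) ->
  M f.
Proof.
move=> qmM archM pos_f.
have [[m [s [Mm sos_s em]]]|proper] := pselect (adjoin M (- f) (- 1)).
  apply: (qm_descent qmM archM sos_s); suff -> : s * f - 1 = m by [].
  by rewrite em; ring.
have qm' := adjoin_qm qmM (- f).
have arch' : archimedean_for iota (adjoin M (- f)).
  by move=> a; have [r Mr] := archM a; exists r; exact: sub_adjoin.
have [phi [phi_iota phi_ge0]] := ex_nonneg_character qm' arch' proper.
have := phi_ge0 _ (adjoin_gen qmM (- f)); rewrite rmorphN oppr_ge0 leNgt.
by rewrite pos_f // => a Ma; apply: phi_ge0; exact: sub_adjoin.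
Qed.

(** * Degrees and sums of squares of polynomials *)

Section Degree.
Variables (R : realType) (n : nat).
Implicit Types (p q : {mpoly R[n]}) (b k l : nat).

Lemma mpdegC (c : R) : mpdeg (c%:MP : {mpoly R[n]}) = 0%N.
Proof. by rewrite /mpdeg mmeasureC; case: eqP. Qed.

Lemma mpdegX (m : 'X_{1..n}) : mpdeg ('X_[m] : {mpoly R[n]}) = mdeg m.
Proof. by rewrite /mpdeg msizeX. Qed.

Lemma mpdegD_le b p q : (mpdeg p <= b)%N -> (mpdeg q <= b)%N ->
  (mpdeg (p + q) <= b)%N.
Proof.
rewrite /mpdeg; have := mmeasureD_le mdeg p q.
by move: (mmeasure _ p) (mmeasure _ q) (mmeasure _ _); lia.
Qed.

Lemma mpdegN p : mpdeg (- p) = mpdeg p.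
Proof. by rewrite /mpdeg mmeasureN. Qed.

Lemma mpdegB_le b p q : (mpdeg p <= b)%N -> (mpdeg q <= b)%N ->
  (mpdeg (p - q) <= b)%N.
Proof. by move=> hp hq; apply: mpdegD_le => //; rewrite mpdegN. Qed.

Lemma mpdegM p q : (mpdeg (p * q) <= mpdeg p + mpdeg q)%N.
Proof.
have [->|nz_p] := eqVneq p 0; first by rewrite mul0r /mpdeg msize0.
have [->|nz_q] := eqVneq q 0; first by rewrite mulr0 /mpdeg msize0.
by rewrite /mpdeg msizeM //; move: (msize p) (msize q); lia.
Qed.

Lemma mpdegM_le b c p q : (mpdeg p <= b)%N -> (mpdeg q <= c)%N ->
  (mpdeg (p * q) <= b + c)%N.
Proof. by move=> hp hq; apply: leq_trans (mpdegM p q) (leq_add hp hq). Qed.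

Lemma mpdeg_sum_le b (I : Type) (r : seq I) (F : I -> {mpoly R[n]}) :
  (forall i, mpdeg (F i) <= b)%N -> (mpdeg (\sum_(i <- r) F i) <= b)%N.
Proof.
move=> hF; apply: (big_ind (fun p => mpdeg p <= b)%N) => // [|p q].
  by rewrite -mpolyC0 mpdegC.
exact: mpdegD_le.
Qed.

Lemma mpdegXn_le b k p : (mpdeg p <= b)%N -> (mpdeg (p ^+ k) <= k * b)%N.
Proof.
move=> hp; elim: k => [|k IH]; first by rewrite expr0 -mpolyC1 mpdegC.
by rewrite exprS mulSn; exact: mpdegM_le.
Qed.

Lemma mpdeg_theta : (mpdeg (theta R n) <= 2)%N.
Proof.
apply: mpdegD_le; first by rewrite -mpolyC1 mpdegC.
by apply: mpdeg_sum_le => i; rewrite mpolyXn mpdegX mdegMn mdeg1.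
Qed.

Lemma mpdeg_thetaX k : (mpdeg (theta R n ^+ k) <= 2 * k)%N.
Proof. by rewrite mulnC; apply: mpdegXn_le; exact: mpdeg_theta. Qed.

Lemma theta_neq0 : theta R n != 0.
Proof.
apply/eqP => /(congr1 (meval (fun=> 0 : R))); rewrite mevalD meval1 meval0.
rewrite raddf_sum big1 /=; first by move=> /eqP; rewrite addr0 oner_eq0.
by move=> i _; rewrite expr2 mevalM mevalXU mul0r.
Qed.

End Degree.

Section SumsOfSquares.
Variables (R : realType) (n : nat).
Implicit Types (p q s : {mpoly R[n]}) (k l : nat).

Lemma is_sos_sqr p : is_sos (p ^+ 2).
Proof. by exists [:: p]; rewrite big_seq1. Qed.

Lemma is_sosD p q : is_sos p -> is_sos q -> is_sos (p + q).
Proof. by move=> [s ->] [t ->]; exists (s ++ t); rewrite big_cat. Qed.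

Lemma is_sos0 : is_sos (0 : {mpoly R[n]}).
Proof. by exists [::]; rewrite big_nil. Qed.

Lemma is_sos_sum (I : Type) (r : seq I) P (F : I -> {mpoly R[n]}) :
  (forall i, is_sos (F i)) -> is_sos (\sum_(i <- r | P i) F i).
Proof.
by move=> hF; apply: big_ind => //; [exact: is_sos0|move=> p q; exact: is_sosD].
Qed.

Lemma is_sosM p q : is_sos p -> is_sos q -> is_sos (p * q).
Proof.
move=> [s ->] [t ->]; rewrite mulr_suml; apply: is_sos_sum => a.
by rewrite mulr_sumr; apply: is_sos_sum => b; rewrite -exprMn; exact: is_sos_sqr.
Qed.

Lemma is_sosC (c : R) : 0 <= c -> is_sos (c%:MP : {mpoly R[n]}).
Proof. by move=> c0; rewrite -(sqr_sqrtr c0) rmorphXn; exact: is_sos_sqr. Qed.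

Lemma is_sos_theta : is_sos (theta R n).
Proof.
apply: is_sosD; first by rewrite -(expr1n _ 2); exact: is_sos_sqr.
by apply: is_sos_sum => i; exact: is_sos_sqr.
Qed.

Lemma is_sosX k p : is_sos p -> is_sos (p ^+ k).
Proof.
move=> sos_p; elim: k => [|k IH]; last by rewrite exprS; exact: is_sosM.
by rewrite expr0 -(expr1n _ 2); exact: is_sos_sqr.
Qed.

(** The products of powers of the x_i^2 are handled through this condition,
    0 <= p <= theta^k up to sums of squares, because it is multiplicative. *)
Definition sos_between0theta (k : nat) p : Prop :=
  is_sos p /\ is_sos (theta R n ^+ k - p).

Lemma sos_between0theta1 : sos_between0theta 0 1.
Proof.
split; last by rewrite expr0 subrr; exact: is_sos0.
by rewrite -(expr1n _ 2); exact: is_sos_sqr.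
Qed.

Lemma sos_between0thetaM k l p q :
  sos_between0theta k p -> sos_between0theta l q ->
  sos_between0theta (k + l) (p * q).
Proof.
move=> [sp tp] [sq tq]; split; first exact: is_sosM.
have -> : theta R n ^+ (k + l) - p * q =
    (theta R n ^+ k - p) * theta R n ^+ l + p * (theta R n ^+ l - q).
  by rewrite exprD; ring.
by apply: is_sosD; apply: is_sosM => //; apply: is_sosX; exact: is_sos_theta.
Qed.

Lemma sos_between0theta_monomial (m : 'X_{1..n}) k : (mdeg m <= k)%N ->
  sos_between0theta k ('X_[m] ^+ 2).
Proof.
move=> le_mk; rewrite -(subnK le_mk) -['X_[m] ^+ 2]mul1r.
apply: sos_between0thetaM.
  elim: (k - mdeg m)%N => [|j IH]; first exact: sos_between0theta1.
  rewrite -add1n -[1]mulr1; apply: sos_between0thetaM => //; split.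
    by rewrite -(expr1n _ 2); exact: is_sos_sqr.
  rewrite expr1 /theta addrC addKr.
  by apply: is_sos_sum => i; exact: is_sos_sqr.
rewrite mpolyXE_id mdegE -prodrXl.
apply: (big_ind2 (fun j q => sos_between0theta j q)).
- exact: sos_between0theta1.
- by move=> j p l q; exact: sos_between0thetaM.
move=> i _; elim: (m i) => [|j IH].
  by rewrite expr0 expr1n; exact: sos_between0theta1.
rewrite (exprS 'X_i j) exprMn -add1n; apply: sos_between0thetaM => //.
split; first exact: is_sos_sqr.
rewrite expr1 /theta (bigD1 i) //=; set S := \sum_(_ < _ | _) _.
have -> : 1 + ('X_i ^+ 2 + S) - 'X_i ^+ 2 = 1 + S by ring.
apply: is_sosD; last by apply: is_sos_sum => i'; exact: is_sos_sqr.
by rewrite -(expr1n _ 2); exact: is_sos_sqr.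
Qed.

(** Each monomial c x^alpha is bounded by a multiple of theta^k through its
    square c^2 x^(2 alpha) <= c^2 theta^(2 k). The factor theta^k makes room for
    that squaring without splitting [alpha] into two halves. *)
Lemma ex_sos_bound k p : (mpdeg p <= 2 * k)%N ->
  exists N : R, is_sos (theta R n ^+ k * (N%:MP * theta R n ^+ k - p)).
Proof.
move=> deg_p; rewrite [p]mpolyE big_seq.
apply: (big_ind (fun q => exists N : R,
   is_sos (theta R n ^+ k * (N%:MP * theta R n ^+ k - q)))).
- by exists 0; rewrite mpolyC0 mul0r subr0 mulr0; exact: is_sos0.
- move=> q r [N sq] [N' sr]; exists (N + N'); rewrite mpolyCD.
  have := is_sosD sq sr; congr is_sos; ring.
move=> m m_p; set c := p@_m.
have le_m2k : (mdeg m <= 2 * k)%N.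
  by move/msize_mdeg_lt: m_p; move: deg_p; rewrite /mpdeg; lia.
exists (2^-1 * (1 + c ^+ 2)); rewrite -mul_mpolyC.
have [_] := sos_between0theta_monomial le_m2k.
rewrite mulnC exprM => sos_m.
(* With N = (1 + c^2) / 2, the element theta^k (N theta^k - c X^m) is half of
   (theta^k - c X^m)^2 + c^2 (theta^(2k) - X^(2m)). *)
have half : (2^-1 : R)%:MP * 2 = 1 :> {mpoly R[n]}.
  by rewrite -(mpolyC_nat _ _ 2) -mpolyCM mulVf ?pnatr_eq0.
have -> : theta R n ^+ k * ((2^-1 * (1 + c ^+ 2))%:MP * theta R n ^+ k - c%:MP * 'X_[m])
  = (2^-1 : R)%:MP * ((theta R n ^+ k - c%:MP * 'X_[m]) ^+ 2
      + c%:MP ^+ 2 * (theta R n ^+ k ^+ 2 - 'X_[m] ^+ 2)).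
  rewrite mpolyCM mpolyCD mpolyC1 rmorphXn /=.
  set h := (2^-1)%:MP in half *; set t := theta R n ^+ k; set X := 'X_[m].
  have -> : t * (h * (1 + c%:MP ^+ 2) * t - c%:MP * X)
     = h * (t ^+ 2 * (1 + c%:MP ^+ 2)) - h * 2 * (t * c%:MP * X).
    by rewrite half; ring.
  by ring.
apply: is_sosM; first by apply: is_sosC; rewrite invr_ge0.
apply: is_sosD; first exact: is_sos_sqr.
by apply: is_sosM => //; exact: is_sos_sqr.
Qed.

Lemma sos_trunc0 (z : int) : sos_trunc z (0 : {mpoly R[n]}).
Proof. by case: z => [k|//]; split; [exact: is_sos0|rewrite -mpolyC0 mpdegC]. Qed.

Lemma sos_truncD (z : int) p q :
  sos_trunc z p -> sos_trunc z q -> sos_trunc z (p + q).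
Proof.
case: z => [k [sp dp] [sq dq]|k /= -> ->]; last by rewrite addr0.
by split; [exact: is_sosD|exact: mpdegD_le].
Qed.

Lemma sos_truncM k (z : int) p q :
  sos_trunc k%:Z p -> sos_trunc z q -> sos_trunc (k%:Z + z) (p * q).
Proof.
case: z => [l [sp dp] [sq dq]|l _ /= ->]; last by rewrite mulr0; exact: sos_trunc0.
split; first exact: is_sosM.
by rewrite mulnDr; exact: mpdegM_le.
Qed.

Lemma sos_trunc_theta k : sos_trunc k%:Z (theta R n ^+ k).
Proof.
by split; [apply: is_sosX; exact: is_sos_theta|exact: mpdeg_thetaX].
Qed.

End SumsOfSquares.

(** * Truncated quadratic modules *)

Section TruncatedModule.
Variables (R : realType) (n m : nat) (g : 'I_m -> {mpoly R[n]}).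
Implicit Types (p q s : {mpoly R[n]}) (k l : nat).

Lemma qmodule_truncD k p q :
  qmodule_trunc g k p -> qmodule_trunc g k q -> qmodule_trunc g k (p + q).
Proof.
move=> [s0 [s [hs0 hs ->]]] [t0 [t [ht0 ht ->]]].
exists (s0 + t0), (fun j => s j + t j); split.
- exact: sos_truncD.
- by move=> j; exact: sos_truncD.
rewrite addrACA -big_split; congr (_ + _); apply: eq_bigr => j _.
by rewrite mulrDl.
Qed.

Lemma qmodule_truncM k l s p :
  sos_trunc k%:Z s -> qmodule_trunc g l p -> qmodule_trunc g (k + l) (s * p).
Proof.
move=> hs [t0 [t [ht0 ht ->]]]; exists (s * t0), (fun j => s * t j); split.
- by rewrite PoszD; exact: sos_truncM.
- by move=> j; rewrite PoszD -addrA; exact: sos_truncM.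
by rewrite mulrDr mulr_sumr; congr (_ + _); apply: eq_bigr => j _; rewrite mulrA.
Qed.

Lemma qmodule_trunc_sos k s : sos_trunc k%:Z s -> qmodule_trunc g k s.
Proof.
move=> hs; exists s, (fun=> 0); split=> // [j|]; first exact: sos_trunc0.
by rewrite big1 ?addr0 // => j _; rewrite mul0r.
Qed.

Lemma qmodule_trunc_gen j : qmodule_trunc g (half_deg (g j)) (g j).
Proof.
exists 0, (fun i => if i == j then 1 else 0); split; first exact: sos_trunc0.
  move=> i; case: eqP => [->|_]; last exact: sos_trunc0.
  by rewrite subrr -(expr0 (theta R n)); exact: sos_trunc_theta.
rewrite add0r (bigD1 j) //= eqxx mul1r big1 ?addr0 // => i /negbTE ->.
by rewrite mul0r.
Qed.

(** The order is lowered by u_j = ceil (deg g_j / 2) in the multiplier of g_j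
    precisely so that each term has degree at most 2 k. *)
Lemma mpdeg_qmodule_trunc k p : qmodule_trunc g k p -> (mpdeg p <= 2 * k)%N.
Proof.
move=> [s0 [s [[_ ds0] hs ->]]]; apply: mpdegD_le => //.
apply: mpdeg_sum_le => j; move: (hs j).
case ez: (k%:Z - (half_deg (g j))%:Z) => [l|l] /=; last first.
  by move=> ->; rewrite mul0r -mpolyC0 mpdegC.
move=> [_ ds]; apply: leq_trans (mpdegM_le ds (leqnn _)) _.
by move: ez; rewrite /half_deg; lia.
Qed.

End TruncatedModule.

(** * Fractions with bounded degree *)

Section BoundedFractions.
Variables (R : realType) (n : nat).
Implicit Types (p q : {mpoly R[n]}) (k l : nat).

Local Notation K := {fraction {mpoly R[n]}}.
Local Notation theta := (theta R n).
Local Notation thetaF := (tofrac theta).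

Lemma thetaF_neq0 k : thetaF ^+ k != 0.
Proof. by rewrite expf_neq0 // tofrac_eq0 theta_neq0. Qed.

(** Divided by theta^k, a polynomial of degree at most 2 k is a bounded
    function on R^n; it is this that makes the ring below archimedean. *)
Definition bounded_fraction : {pred K} :=
  [pred a | `[< exists k p, (mpdeg p <= 2 * k)%N /\ a = tofrac p / thetaF ^+ k >]].

Lemma bounded_fraction_subring : subring_closed bounded_fraction.
Proof.
split.
- apply/asboolP; exists 0%N, 1; rewrite -mpolyC1 mpdegC; split=> //.
  by rewrite mpolyC1 tofrac1 expr0 divr1.
- move=> a b /asboolP[k [p [dp ->]]] /asboolP[l [q [dq ->]]].
  apply/asboolP; exists (k + l)%N, (p * theta ^+ l - q * theta ^+ k); split.
    rewrite mulnDr; apply: mpdegB_le.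
      by apply: mpdegM_le => //; exact: mpdeg_thetaX.
    by rewrite addnC; apply: mpdegM_le => //; exact: mpdeg_thetaX.
  rewrite -mulNr addf_div ?thetaF_neq0 // -exprD mulNr.
  by rewrite tofracB !tofracM !tofracXn.
move=> a b /asboolP[k [p [dp ->]]] /asboolP[l [q [dq ->]]].
apply/asboolP; exists (k + l)%N, (p * q); split.
  by rewrite mulnDr; exact: mpdegM_le.
by rewrite mulf_div -exprD tofracM.
Qed.

HB.instance Definition _ :=
  GRing.isSubringClosed.Build K bounded_fraction bounded_fraction_subring.

Record bfrac := BFrac { bfrac_val :> K; _ : bfrac_val \in bounded_fraction }.

HB.instance Definition _ := [isSub for bfrac_val].
HB.instance Definition _ := [Choice of bfrac by <:].
HB.instance Definition _ := [SubChoice_isSubComNzRing of bfrac by <:].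

(** The fraction p / theta^k; it is meaningful when deg p <= 2 k and falls
    back to 0 otherwise. *)
Definition hfrac k p : bfrac := insubd 0 (tofrac p / thetaF ^+ k).

Lemma val_hfrac k p : (mpdeg p <= 2 * k)%N ->
  val (hfrac k p) = tofrac p / thetaF ^+ k.
Proof. by move=> dp; rewrite insubdK //; apply/asboolP; exists k, p. Qed.

Lemma hfracP (a : bfrac) : exists k p, (mpdeg p <= 2 * k)%N /\ a = hfrac k p.
Proof.
have /asboolP[k [p [dp ea]]] := valP a; exists k, p; split=> //.
by apply: val_inj; rewrite val_hfrac.
Qed.

Lemma hfrac_eq k l p q : (mpdeg p <= 2 * k)%N -> (mpdeg q <= 2 * l)%N ->
  hfrac k p = hfrac l q <-> p * theta ^+ l = q * theta ^+ k.
Proof.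
move=> dp dq; have hk := thetaF_neq0 k; have hl := thetaF_neq0 l.
have val_eq : val (hfrac k p) = val (hfrac l q) <->
    tofrac p * thetaF ^+ l = tofrac q * thetaF ^+ k.
  rewrite (val_hfrac dp) (val_hfrac dq).
  by split => [/eqP|/eqP] e; apply/eqP; move: e; rewrite (eqr_div _ _ hk hl).
have tofrac_eqE : tofrac p * thetaF ^+ l = tofrac q * thetaF ^+ k <->
    p * theta ^+ l = q * theta ^+ k.
  rewrite -!tofracXn -!tofracM.
  by split=> [/eqP|->//]; rewrite tofrac_eq => /eqP.
split=> [e|e].
  by apply/tofrac_eqE/val_eq; rewrite e.
by apply/val_inj/val_eq/tofrac_eqE.
Qed.

Lemma hfracM k l p q : (mpdeg p <= 2 * k)%N -> (mpdeg q <= 2 * l)%N ->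
  hfrac (k + l) (p * q) = hfrac k p * hfrac l q.
Proof.
move=> dp dq; apply: val_inj; rewrite rmorphM /= !val_hfrac //; last first.
  by rewrite mulnDr; exact: mpdegM_le.
by rewrite mulf_div -exprD tofracM.
Qed.

Lemma hfracB k p q : (mpdeg p <= 2 * k)%N -> (mpdeg q <= 2 * k)%N ->
  hfrac k (p - q) = hfrac k p - hfrac k q.
Proof.
move=> dp dq; apply: val_inj; rewrite rmorphB /= !val_hfrac //.
  by rewrite tofracB mulrBl.
exact: mpdegB_le.
Qed.

Lemma hfracD k p q : (mpdeg p <= 2 * k)%N -> (mpdeg q <= 2 * k)%N ->
  hfrac k (p + q) = hfrac k p + hfrac k q.
Proof.
move=> dp dq; apply: val_inj; rewrite rmorphD /= !val_hfrac //.
  by rewrite tofracD mulrDl.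
exact: mpdegD_le.
Qed.

Lemma hfrac_theta k : hfrac k (theta ^+ k) = 1.
Proof.
apply: val_inj; rewrite val_hfrac ?mpdeg_thetaX // rmorph1 tofracXn divff //.
exact: thetaF_neq0.
Qed.

Lemma hfrac_thetaM k l p : (mpdeg p <= 2 * k)%N ->
  hfrac (l + k) (theta ^+ l * p) = hfrac k p.
Proof. by move=> dp; rewrite hfracM ?mpdeg_thetaX // hfrac_theta mul1r. Qed.

Definition bfracC (c : R) : bfrac := hfrac 0 c%:MP.

Lemma bfracC_zmod : zmod_morphism bfracC.
Proof. by move=> a b; rewrite /bfracC mpolyCB hfracB ?mpdegC. Qed.

Lemma bfracC_monoid : monoid_morphism bfracC.
Proof.
split; first by rewrite /bfracC mpolyC1 -(expr0 theta) hfrac_theta.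
by move=> a b; rewrite /bfracC mpolyCM -hfracM ?mpdegC.
Qed.

HB.instance Definition _ := GRing.isZmodMorphism.Build R bfrac bfracC bfracC_zmod.
HB.instance Definition _ := GRing.isMonoidMorphism.Build R bfrac bfracC bfracC_monoid.

End BoundedFractions.

(** * The quadratic module of fractions *)

Section FractionModule.
Variables (R : realType) (n m : nat) (g : 'I_m -> {mpoly R[n]}).
Local Notation theta := (theta R n).

Definition qmodule_frac (a : bfrac R n) : Prop :=
  exists k p, qmodule_trunc g k p /\ a = hfrac k p.

Lemma qm_qmodule_frac : quadratic_module qmodule_frac.
Proof.
split.
- exists 0%N, (theta ^+ 0); rewrite hfrac_theta; split=> //.
  by apply: qmodule_trunc_sos; exact: sos_trunc_theta.
- move=> _ _ [k [p [Qp ->]]] [l [q [Qq ->]]].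
  have dp := mpdeg_qmodule_trunc Qp; have dq := mpdeg_qmodule_trunc Qq.
  have Qp' := qmodule_truncM (sos_trunc_theta R n l) Qp.
  have Qq' := qmodule_truncM (sos_trunc_theta R n k) Qq.
  rewrite addnC in Qq'; exists (l + k)%N, (theta ^+ l * p + theta ^+ k * q).
  split; first exact: qmodule_truncD.
  rewrite hfracD; [|exact: mpdeg_qmodule_trunc Qp'|exact: mpdeg_qmodule_trunc Qq'].
  by rewrite hfrac_thetaM // (addnC l k) hfrac_thetaM.
move=> a _ [k [p [Qp ->]]]; have [l [q [dq ->]]] := hfracP a.
exists (l + l + k)%N, (q ^+ 2 * p); split.
  apply: qmodule_truncM => //; split; first exact: is_sos_sqr.
  by rewrite mulnDr expr2; exact: mpdegM_le.
rewrite hfracM; last exact: mpdeg_qmodule_trunc Qp.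
  by rewrite !expr2 hfracM.
by rewrite mulnDr expr2; exact: mpdegM_le.
Qed.

Lemma archimedean_qmodule_frac :
  archimedean_for (@bfracC R n : {rmorphism R -> bfrac R n}) qmodule_frac.
Proof.
move=> a; have [k [p [dp ->]]] := hfracP a; have [N sosN] := ex_sos_bound dp.
have dN : (mpdeg (N%:MP * theta ^+ k : {mpoly R[n]}) <= 2 * k)%N.
  by rewrite -[(2 * k)%N]add0n; apply: mpdegM_le; rewrite ?mpdegC // mpdeg_thetaX.
exists N, (k + k)%N, (theta ^+ k * (N%:MP * theta ^+ k - p)); split.
  apply: qmodule_trunc_sos; split=> //; rewrite mulnDr.
  by apply: mpdegM_le; [exact: mpdeg_thetaX|exact: mpdegB_le].
rewrite hfrac_thetaM ?mpdegB_le // hfracB // -[k in X in _ = X - _]add0n.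
by rewrite hfracM ?mpdegC ?mpdeg_thetaX // hfrac_theta mulr1.
Qed.

Lemma qmodule_frac_gen j : qmodule_frac (hfrac (half_deg (g j)) (g j)).
Proof. by exists (half_deg (g j)), (g j); split=> //; exact: qmodule_trunc_gen. Qed.

Lemma qmodule_frac_theta_inv : qmodule_frac (hfrac 1 1).
Proof.
exists 1%N, 1; split=> //; apply: qmodule_trunc_sos; split.
  by rewrite -(expr1n _ 2); exact: is_sos_sqr.
by rewrite -mpolyC1 mpdegC.
Qed.

(** Clearing denominators: if p / theta^d = q / theta^k with q in Q_k(g), then
    theta^k p = theta^d q, and theta^d is itself a sum of squares. *)
Lemma qmodule_frac_hfrac d p : (mpdeg p <= 2 * d)%N ->
  qmodule_frac (hfrac d p) -> exists k, qmodule_trunc g (k + d) (theta ^+ k * p).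
Proof.
move=> dp [k [q [Qq /hfrac_eq e]]]; exists k; rewrite mulrC e //.
  by rewrite mulrC addnC; apply: qmodule_truncM => //; exact: sos_trunc_theta.
exact: mpdeg_qmodule_trunc Qq.
Qed.

End FractionModule.

(** * Real points of the ring of fractions *)

Section Characters.
Variables (R : realType) (n : nat) (phi : {rmorphism bfrac R n -> R}).
Hypothesis phiC : forall c, phi (bfracC n c) = c.
Implicit Types (p q : {mpoly R[n]}) (k l : nat).

Local Notation theta := (theta R n).
Local Notation t := (phi (hfrac 1 1)).

Lemma mpdeg1_le b : (mpdeg (1 : {mpoly R[n]}) <= b)%N.
Proof. by rewrite -mpolyC1 mpdegC. Qed.

(** The square p^2 / theta^(2k) still has room for a factor 1 / theta, since
    deg p^2 <= 4 k - 2, so it is killed by a morphism that kills 1 / theta. *)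
Lemma char_at_infinity k p : t = 0 -> (mpdeg p < 2 * k)%N ->
  phi (hfrac k p) = 0.
Proof.
move=> t0 dp; apply/eqP; rewrite -sqrf_eq0 -rmorphXn /= expr2 -hfracM ?(ltnW dp) //.
have -> : (k + k = (k + k).-1 + 1)%N by lia.
rewrite -[p * p]mulr1 hfracM ?mpdeg1_le //; first by rewrite rmorphM /= t0 mulr0.
by apply: leq_trans (mpdegM p p) _; lia.
Qed.

Lemma char_shift k l p : (mpdeg p <= 2 * k)%N ->
  phi (hfrac (k + l) p) = phi (hfrac k p) * t ^+ l.
Proof.
elim: l => [|l IH] dp; first by rewrite addn0 expr0 mulr1.
rewrite addnS -addn1 -[p in LHS]mulr1 hfracM ?mpdeg1_le //; last by lia.
by rewrite rmorphM /= IH // exprSr mulrA.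
Qed.

(** The order [k] does not matter once [t] is nonzero ([evaluates_all]), which
    is what allows the polynomials evaluated at [x] to be added. *)
Definition evaluates (x : 'I_n -> R) p : Prop :=
  exists k, (mpdeg p <= 2 * k)%N /\ phi (hfrac k p) = t ^+ k * p.@[x].

Section Affine.
Hypothesis t_neq0 : t != 0.

Let x (i : 'I_n) : R := phi (hfrac 1 'X_i) / t.

Lemma evaluates_all k p : evaluates x p -> (mpdeg p <= 2 * k)%N ->
  phi (hfrac k p) = t ^+ k * p.@[x].
Proof.
move=> [l [dpl e]] dpk; apply: (@mulIf _ (t ^+ l)); first by rewrite expf_neq0.
rewrite -char_shift // addnC char_shift // e; ring.
Qed.

Lemma evaluatesM p q : evaluates x p -> evaluates x q -> evaluates x (p * q).
Proof.
move=> [k [dp ep]] [l [dq eq]]; exists (k + l)%N; split.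
  by rewrite mulnDr; exact: mpdegM_le.
by rewrite hfracM // rmorphM /= ep eq mevalM exprD; ring.
Qed.

Lemma evaluatesD p q : evaluates x p -> evaluates x q -> evaluates x (p + q).
Proof.
move=> ep eq; have [[k [dp _]] [l [dq _]]] := (ep, eq).
exists (k + l)%N.
have dp' : (mpdeg p <= 2 * (k + l))%N by lia.
have dq' : (mpdeg q <= 2 * (k + l))%N by lia.
split; first exact: mpdegD_le.
rewrite hfracD // rmorphD /= (evaluates_all ep dp') (evaluates_all eq dq').
by rewrite mevalD mulrDr.
Qed.

Lemma evaluatesC c : evaluates x c%:MP.
Proof. by exists 0%N; rewrite mpdegC phiC mevalC expr0 mul1r. Qed.

(** The polynomials that [phi] evaluates at [x] contain the constants and the
    variables, by the choice of [x], and form a ring. *)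
Lemma evaluates_mpoly p : evaluates x p.
Proof.
rewrite [p]mpolyE; apply: big_ind => [||m _].
  by rewrite -mpolyC0; exact: evaluatesC.
  exact: evaluatesD.
rewrite -mul_mpolyC; apply: evaluatesM; first exact: evaluatesC.
rewrite mpolyXE_id; apply: big_ind => [||i _].
  by rewrite -mpolyC1; exact: evaluatesC.
  exact: evaluatesM.
elim: (m i) => [|j IH]; first by rewrite expr0 -mpolyC1; exact: evaluatesC.
rewrite exprS; apply: evaluatesM => //; exists 1%N; split.
  by rewrite mpdegX mdeg1.
by rewrite expr1 mevalXU /x mulrCA mulfV // mulr1.
Qed.

End Affine.

Lemma char_affine : t != 0 -> exists x : 'I_n -> R,
  forall k p, (mpdeg p <= 2 * k)%N -> phi (hfrac k p) = t ^+ k * p.@[x].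
Proof.
move=> t0; exists (fun i => phi (hfrac 1 'X_i) / t) => k p.
by apply: evaluates_all => //; exact: evaluates_mpoly.
Qed.

End Characters.

(** At an affine point, [f] is evaluated at a point of S(g). At infinity, only
    the terms of degree 2 d of [f] count, and they are those of g_j, whose
    half degree is then exactly [d], so that g_j / theta^d is in the
    module. *)
Lemma char_nonneg (R : realType) (n m : nat) (g : 'I_m -> {mpoly R[n]})
    (f : {mpoly R[n]}) (d : nat) (phi : {rmorphism bfrac R n -> R}) :
  (forall c, phi (bfracC n c) = c) ->
  (forall a, qmodule_frac g a -> 0 <= phi a) ->
  (forall x : 'I_n -> R, semialg g x -> 0 <= f.@[x]) ->
  (0 < d)%N -> (mpdeg f <= 2 * d)%N ->
  (mpdeg f = (2 * d)%N -> exists (j : 'I_m) (lam : R), g j = f + lam%:MP) ->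
  0 <= phi (hfrac d f).
Proof.
move=> phiC phi_ge0 hf d_gt0 df hg.
have t_ge0 : 0 <= phi (hfrac 1 1) by apply: phi_ge0; exact: qmodule_frac_theta_inv.
have [t0|t_neq0] := eqVneq (phi (hfrac 1 1)) 0.
  move: df; rewrite leq_eqVlt => /orP[/eqP df|df]; last by rewrite char_at_infinity.
  have [j [lam ej]] := hg df.
  have dlam : (mpdeg (lam%:MP : {mpoly R[n]}) < 2 * d)%N by rewrite mpdegC; lia.
  have dgj : half_deg (g j) = d.
    have le_g : (mpdeg (g j) <= 2 * d)%N.
      by rewrite ej; apply: mpdegD_le; [rewrite df|exact: ltnW].
    have le_f : (2 * d <= mpdeg (g j))%N.
      rewrite leqNgt; apply/negP => lt_g; have : (mpdeg f <= (2 * d).-1)%N.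
        have -> : f = g j - lam%:MP by rewrite ej addrK.
        by apply: mpdegB_le; lia.
      by lia.
    by rewrite /half_deg; lia.
  have := phi_ge0 _ (qmodule_frac_gen g j).
  rewrite dgj ej hfracD ?df //; last exact: ltnW.
  by rewrite rmorphD /= (char_at_infinity t0 dlam) addr0.
have [x ex] := char_affine phiC t_neq0.
have t_gt0 : 0 < phi (hfrac 1 1) by rewrite lt_def t_neq0.
rewrite ex // pmulr_rge0 ?exprn_gt0 //; apply: hf => j.
have := phi_ge0 _ (qmodule_frac_gen g j); rewrite ex ?pmulr_rge0 ?exprn_gt0 //.
by rewrite /half_deg; lia.
Qed.

Theorem theorem3p2 (R : realType) (n m : nat)
    (g : 'I_m -> {mpoly R[n]}) (f : {mpoly R[n]})
    (hf : forall x : 'I_n -> R, semialg g x -> 0 <= f.@[x])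
    (eps : R) (heps : 0 < eps) (d : nat)
    (hd : (1 + (mpdeg f)./2 <= d)%N \/
          ((uphalf (mpdeg f) <= d)%N /\
           exists (j : 'I_m) (lam : R),
             [/\ j.+1 = m, 0 <= lam & g j = f + lam%:MP]))
    (hS : d = 0%N -> exists x : 'I_n -> R, semialg g x) :
  exists k : nat,
    qmodule_trunc g (k + d) (theta R n ^+ k * (f + eps *: theta R n ^+ d)).
Proof.
have df : (mpdeg f <= 2 * d)%N by case: hd => [|[]]; lia.
have deps : (mpdeg (eps%:MP * theta R n ^+ d) <= 2 * d)%N.
  by rewrite -[(2 * d)%N]add0n; apply: mpdegM_le; rewrite ?mpdegC // mpdeg_thetaX.
rewrite -mul_mpolyC; apply: qmodule_frac_hfrac; first exact: mpdegD_le.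
apply: (archimedean_positivstellensatz (qm_qmodule_frac g)
  (archimedean_qmodule_frac g)) => phi phiC phi_ge0.
rewrite hfracD // rmorphD /= -[d in X in _ < _ + X]add0n.
rewrite (hfracM (k := 0)) ?mpdegC ?mpdeg_thetaX // hfrac_theta mulr1.
rewrite phiC ltr_wpDl //.
have [d0|d_gt0] := posnP d; last first.
  apply: (char_nonneg phiC phi_ge0 hf d_gt0 df) => df2.
  by case: hd => [|[_ [j [lam [_ _ ej]]]]]; [lia|exists j, lam].
(* For d = 0 the polynomial f is constant, and a point of S(g) gives its sign. *)
have [x Sx] := hS d0.
have df0 : mpdeg f = 0%N by move: df; rewrite d0; lia.
have ef : f = (f@_0)%:MP by apply: msize1_polyC; move: df0; rewrite /mpdeg; lia.
by have := hf x Sx; rewrite d0 ef mevalC phiC.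
Qed.
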